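(* Let $k=k(n)\ge 10\sqrt n$. There are constants $C_0,r>0$ such that, with probability at least $1-e^{-n^r}$ over $G'\sim G(n,\tfrac12)$, for every set $K$ of $k$ vertices, the graph $G$ obtained from $G'$ by adding all missing edges inside $K$ satisfies $k\le \vartheta(\bar G)\le k+C_0\log n$.
   Context: $G(n,p)$ is the Erdős–Rényi random graph with edge probability $p$; $\bar G$ is the edge complement of $G$. For a graph $F=(V,E)$, an orthonormal representation is a family of unit vectors $s_i\in\mathbb R^{|V|}$, $i\in V$, with $s_i\cdot s_j=0$ whenever $(i,j)\in E$; the Lovász theta function is $\vartheta(F)=\max_{h,\{s_i\}}\sum_{i\in V}(h\cdot s_i)^2$, the maximum over orthonormal representations $\{s_i\}$ of $F$ and unit vectors $h$. Logarithms are base $2$. *)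

(* Defs.v *)
From HB Require Import structures.
From mathcomp Require Import all_boot all_order all_algebra.
From mathcomp Require Import all_classical all_reals all_analysis.
Set Implicit Arguments. Unset Strict Implicit. Unset Printing Implicit Defensive.
Import Order.TTheory GRing.Theory Num.Theory.

Local Open Scope ring_scope.

(* Graphs on the vertex set 'I_n are represented by their edge sets:
   sets of 2-element subsets of 'I_n. *)
Definition pairs (n : nat) : {set {set 'I_n}} := [set e : {set 'I_n} | #|e| == 2%N].

(* The sample space of G(n,1/2): all edge sets, each with equal probability. *)
Definition graphs (n : nat) : {set {set {set 'I_n}}} := powerset (pairs n).

Definition compl_graph (n : nat) (E : {set {set 'I_n}}) : {set {set 'I_n}} :=
  pairs n :\: E.

Definition add_clique (n : nat) (E : {set {set 'I_n}}) (K : {set 'I_n}) :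
  {set {set 'I_n}} := E :|: [set e in pairs n | e \subset K].

Definition dotv (R : realType) (n : nat) (u v : 'rV[R]_n) : R := (u *m v^T) 0 0.

Definition ortho_rep (R : realType) (n : nat) (E : {set {set 'I_n}})
  (s : 'I_n -> 'rV[R]_n) : Prop :=
  (forall i, dotv (s i) (s i) = 1) /\
  (forall i j, i != j -> [set i; j] \in E -> dotv (s i) (s j) = 0).

(* Lovász theta function: max (= sup; the max is attained) of
   sum_i (h . s_i)^2 over orthonormal representations s and unit vectors h. *)
Definition theta (R : realType) (n : nat) (E : {set {set 'I_n}}) : R :=
  sup (fun t : R => exists (h : 'rV[R]_n) (s : 'I_n -> 'rV[R]_n),
         [/\ dotv h h = 1, ortho_rep E s & t = \sum_(i < n) (dotv h (s i)) ^+ 2]).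

Definition log2 (R : realType) (x : R) : R := ln x / ln 2.

Definition prob_gnp (R : realType) (n : nat) (P : {set {set 'I_n}} -> bool) : R :=
  #|[set E in graphs n | P E]|%:R / #|graphs n|%:R.

(* Main.v *)
(** Write [A] for the signed adjacency matrix of [G'] (entries 1 on edges, -1 on
    non-edges, 0 on the diagonal) and let [t_i] be the sum of [A i j] over [j] in
    [K].  Two properties hold except with probability exponentially small in
    [sqrt n]: the quadratic form of [A] is at most [5.5 sqrt n |x|^2] in absolute
    value, and for every [K] of size [k] at most [O(log n)] vertices outside [K]
    are atypical, meaning [t_i > k / 10].  The first follows from a Chernoff bound
    over an integer grid of [e^(4.4 n)] points: since the diagonal of [A]
    vanishes, a real vector can be rounded to the grid without decreasing the
    form.  The second is a Chernoff bound and a union bound over [K] and the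
    atypical vertices.

    Each atypical vertex contributes at most 1 to the theta function.  The other
    vertices are handled by weak duality: a matrix that is 1 on the diagonal and
    on the edges of [G] bounds theta by its largest eigenvalue.  The matrix is 1
    on [K], [A + I] outside [K], and its non-edges between a vertex [i] and [K]
    are reweighted so that row [i] becomes [k / (k - t_i)] times the projection of
    the row of [A] orthogonally to [1_K].  Then [1_K] splits off with eigenvalue
    [k], and [k >= 10 sqrt n] absorbs the rest. *)
Require Import Defs.
From HB Require Import structures.
From mathcomp Require Import all_boot all_order all_algebra.
From mathcomp Require Import all_classical all_reals all_analysis.
From mathcomp Require Import ring lra.
Import Order.TTheory GRing.Theory Num.Theory.
Local Open Scope ring_scope.

Set Implicit Arguments.
Unset Strict Implicit.

(** * Chernoff bound for linear forms in the signed adjacency matrix *)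

(** Compare Taylor series: the odd terms cancel on the left, and in degree [2 * j] the inequality
    reduces to [2 ^ j * j! <= (2 * j)!]. *)
Lemma expR_cosh_le (R : realType) (x : R) :
  expR x + expR (- x) <= 2 * expR (x ^+ 2 / 2).
Proof.
have c1 := is_cvg_series_exp_coeff x.
have c2 := is_cvg_series_exp_coeff (- x).
rewrite {1 2}/expR -limD//.
apply: limr_le; first exact: is_cvgD.
apply: nearW => m.
rewrite -[X in X <= _]/(series (exp_coeff x) m + series (exp_coeff (- x)) m).
rewrite !seriesEnat -big_split /=.
set F := fun k => exp_coeff x k + exp_coeff (- x) k.
have F0 k : 0 <= F k.
  rewrite /F /exp_coeff /= exprNn -signr_odd -mulrDl; case ok: (odd k).
    by rewrite expr1 mulN1r subrr mul0r.
  rewrite expr0 mul1r divr_ge0// -[k]odd_double_half ok add0n -mul2n exprM.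
  by rewrite addr_ge0// exprn_ge0// sqr_ge0.
apply: (@le_trans _ _ (\sum_(0 <= k < m.*2) F k)).
  rewrite (@big_cat_nat _ _ _ m 0%N m.*2)//= -?addnn ?leq_addr//.
  by rewrite lerDl sumr_ge0.
apply: (@le_trans _ _ (2 * \sum_(0 <= j < m) exp_coeff (x ^+ 2 / 2) j)).
  elim: (m) => [|p IH]; first by rewrite !big_geq// mulr0.
  rewrite doubleS !big_nat_recr//= mulrDr -addrA lerD//.
  have -> : F p.*2.+1 = 0.
    by rewrite /F /exp_coeff /= exprNn -signr_odd /= odd_double mulN1r mulNr subrr.
  have -> : F p.*2 = 2 * exp_coeff x p.*2.
    rewrite /F /exp_coeff /= exprNn -signr_odd /= odd_double expr0 mul1r.
    by rewrite mulr_natl mulr2n.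
  rewrite addr0 /exp_coeff /= -mul2n exprM.
  rewrite ler_pM2l// (exprMn p (x ^+ 2)) -[X in _ <= X]mulrA.
  apply: ler_wpM2l; first by rewrite exprn_ge0 ?sqr_ge0.
  rewrite exprVn -invfM lef_pV2 ?posrE ?mulr_gt0 ?exprn_gt0 ?ltr0n ?fact_gt0//.
  rewrite -natrX -natrM ler_nat.
  elim: p {IH} => // p IH.
  rewrite mulnS add2n !factS expnS mulnACA -[(2 * p).+2]add2n -mulnS.
  by rewrite leq_mul2l/= (leq_trans IH)// leq_pmull.
rewrite ler_pM2l//.
have := @nondecreasing_cvgn_le R (series (exp_coeff (x ^+ 2 / 2))).
rewrite seriesEnat; apply => //.
  apply: nondecreasing_series => k _ _; apply: exp_coeff_ge0.
  by rewrite divr_ge0// sqr_ge0.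
by have := is_cvg_series_exp_coeff (x ^+ 2 / 2); rewrite seriesEnat.
Qed.

Definition signed_adj (R : realType) (n : nat) (E : {set {set 'I_n}})
  (i j : 'I_n) : R :=
  if i == j then 0 else if [set i; j] \in E then 1 else -1.

(** Grouping the two orientations of each pair leaves one independent sign per pair, as the
    exponential moment needs; [w] may be asymmetric. *)
Lemma signed_adj_sum_pairs (R : realType) (n : nat) (E : {set {set 'I_n}})
    (w : 'I_n -> 'I_n -> R) :
  \sum_i \sum_j signed_adj R E i j * w i j =
  \sum_(e in pairs n) (if e \in E then 1 else -1) *
    \sum_(p : 'I_n * 'I_n | (p.1 != p.2) && ([set p.1; p.2] == e)) w p.1 p.2.
Proof.
rewrite pair_bigA /= (bigID (fun p : 'I_n * 'I_n => p.1 == p.2)) /=.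
rewrite big1 ?add0r; last by move=> p pp; rewrite /signed_adj pp mul0r.
rewrite (partition_big (fun p : 'I_n * 'I_n => [set p.1; p.2]) (fun e => e \in pairs n)).
  apply: eq_bigr => e _; rewrite big_distrr /=; apply: eq_bigr => p.
  by rewrite /signed_adj => /andP[/negbTE -> /eqP ->].
by move=> p pp; rewrite /= inE cards2 pp.
Qed.

(** Each fibre consists of the two orientations of one pair, and [(x + y)^2 <= 2 (x^2 + y^2)]. *)
Lemma pairs_fiber_sum_sqr (R : realType) (n : nat) (w : 'I_n -> 'I_n -> R) :
  \sum_(e in pairs n)
    (\sum_(p : 'I_n * 'I_n | (p.1 != p.2) && ([set p.1; p.2] == e)) w p.1 p.2) ^+ 2
  <= 2 * \sum_i \sum_j w i j ^+ 2.
Proof.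
rewrite pair_bigA /= mulr_sumr.
apply: (@le_trans _ _
    (\sum_(p : 'I_n * 'I_n | p.1 != p.2) 2 * w p.1 p.2 ^+ 2)); last first.
  rewrite [leRHS](bigID (fun p : 'I_n * 'I_n => p.1 != p.2)) /= lerDl.
  by apply: sumr_ge0 => p _; rewrite mulr_ge0 ?sqr_ge0.
rewrite [leRHS](partition_big (fun p : 'I_n * 'I_n => [set p.1; p.2])
  (fun e => e \in pairs n)) /=; last by move=> p pp; rewrite /= inE cards2 pp.
apply: ler_sum => e eP; have : #|e| == 2%N by move: eP; rewrite inE.
move=> /cards2P[a [b [ab ->]]].
have fib (F : 'I_n * 'I_n -> R) :
    \sum_(p | (p.1 != p.2) && ([set p.1; p.2] == [set a; b])) F p =
    F (a, b) + F (b, a).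
  rewrite (bigD1 (a, b)) /= ?ab ?eqxx//; congr (_ + _).
  rewrite (bigD1 (b, a)) /=; last first.
    by rewrite eq_sym ab finset.setUC eqxx xpair_eqE negb_and eq_sym ab.
  rewrite big1 ?addr0// => -[i j] /=; rewrite !xpair_eqE.
  move=> /andP[/andP[/andP[ij /eqP e2] n1] n2]; exfalso.
  have: i \in [set a; b] by rewrite -e2 !inE eqxx.
  have: j \in [set a; b] by rewrite -e2 !inE eqxx orbT.
  rewrite !inE => /orP[]/eqP ej /orP[]/eqP ei; subst i j;
    by move: ij n1 n2; rewrite !eqxx.
rewrite !fib /= -subr_ge0.
have -> : 2 * w a b ^+ 2 + 2 * w b a ^+ 2 - (w a b + w b a) ^+ 2 =
  (w a b - w b a) ^+ 2 by ring.
exact: sqr_ge0.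
Qed.

(** Independence of the edges: expanding the product on the right chooses, for every pair, whether
    it is present. *)
Lemma sum_graphs_prod (R : realType) (n : nat) (f g : {set 'I_n} -> R) :
  \sum_(E in graphs n) \prod_(e in pairs n) (if e \in E then f e else g e) =
  \prod_(e in pairs n) (f e + g e).
Proof.
rewrite [RHS]big_mkcond /=.
transitivity (\prod_e ((if e \in pairs n then f e else 0) +
                       (if e \in pairs n then g e else 1))); last first.
  by apply: eq_bigr => e _; case: ifP => // _; rewrite add0r.
rewrite bigA_distr big_mkcond /=; apply: eq_bigr => E _.
rewrite /graphs powersetE; case: ifPn => [/fintype.subsetP sE|/subsetPn[e eE en]].
  rewrite big_mkcond /=; apply: eq_bigr => e _.
  by case: (boolP (e \in E)) => [/sE -> //|_]; case: ifP.
by rewrite (bigD1 e)//= eE (negbTE en) mul0r.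
Qed.

Lemma signed_adj_chernoff (R : realType) (n : nat) (w : 'I_n -> 'I_n -> R)
    (V t : R) :
  0 < V -> \sum_i \sum_j w i j ^+ 2 <= V -> 0 <= t ->
  #|[set E in graphs n | t <= \sum_i \sum_j signed_adj R E i j * w i j]|%:R
  <= #|graphs n|%:R * expR (- (t ^+ 2 / (4 * V))).
Proof.
(* This [l] minimises the exponent [l^2 V - l t] that Markov's inequality and the moment bound
   produce. *)
move=> V0 wV t0; pose l := t / (2 * V).
have l0 : 0 <= l by rewrite divr_ge0// mulr_ge0// ltW.
pose S (E : {set {set 'I_n}}) := \sum_i \sum_j signed_adj R E i j * w i j.
pose c e := \sum_(p : 'I_n * 'I_n | (p.1 != p.2) && ([set p.1; p.2] == e)) w p.1 p.2.
apply: (@le_trans _ _ (\sum_(E in graphs n) expR (l * S E - l * t))).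
  rewrite -sum1_card natr_sum big_mkcond /= [leRHS]big_mkcond /=.
  apply: ler_sum => E _; rewrite inE; case: (E \in graphs n) => //=.
  case: ifP => [tS|_]; last exact: expR_ge0.
  by rewrite -expR0 ler_expR subr_ge0 ler_wpM2l.
under eq_bigr => E _ do rewrite expRD mulrC.
rewrite -mulr_sumr.
have -> : \sum_(E in graphs n) expR (l * S E) =
    \prod_(e in pairs n) (expR (l * c e) + expR (- (l * c e))).
  rewrite -sum_graphs_prod; apply: eq_bigr => E _.
  rewrite /S signed_adj_sum_pairs mulr_sumr expR_sum; apply: eq_bigr => e _.
  by case: ifP => _; rewrite ?mul1r// mulN1r mulrN.
have le1 : \prod_(e in pairs n) (expR (l * c e) + expR (- (l * c e)))
    <= #|graphs n|%:R * expR (l ^+ 2 * V).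
  apply: (@le_trans _ _ (\prod_(e in pairs n) (2 * expR ((l * c e) ^+ 2 / 2)))).
    apply: ler_prod => e _; rewrite expR_cosh_le andbT.
    by rewrite addr_ge0// expR_ge0.
  rewrite big_split /= prodr_const card_powerset natrX -expR_sum ler_pM2l ?exprn_gt0//.
  rewrite ler_expR.
  have -> : \sum_(e in pairs n) (l * c e) ^+ 2 / 2 =
      l ^+ 2 / 2 * \sum_(e in pairs n) c e ^+ 2.
    by rewrite mulr_sumr; apply: eq_bigr => e _; rewrite exprMn mulrAC.
  have := pairs_fiber_sum_sqr w; rewrite -/c => le2.
  apply: (@le_trans _ _ (l ^+ 2 / 2 * (2 * V))); last by rewrite mulrA divfK.
  by rewrite ler_wpM2l ?divr_ge0 ?sqr_ge0// (le_trans le2)// ler_pM2l.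
apply: (le_trans (ler_wpM2l (expR_ge0 _) le1)).
rewrite mulrCA ler_wpM2l// -expRD ler_expR le_eqVlt; apply/orP; left; apply/eqP.
by rewrite /l; field; rewrite gt_eqF.
Qed.

(** * Rounding a quadratic form to integer points *)

Lemma quadform_update (R : realType) (n : nat) (a : 'I_n -> 'I_n -> R)
    (x : 'I_n -> R) (i0 : 'I_n) (d : R) :
  (forall i j, a i j = a j i) -> (forall i, a i i = 0) ->
  let x' := fun i => if i == i0 then x i + d else x i in
  \sum_i \sum_j a i j * (x' i * x' j) =
  \sum_i \sum_j a i j * (x i * x j) + d * (2 * \sum_j a i0 j * x j).
Proof.
move=> asym a0 x'.
pose e i : R := (i == i0)%:R.
have x'E i : x' i = x i + d * e i.
  by rewrite /x' /e; case: eqP => _; rewrite ?mulr1// mulr0 addr0.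
have -> : \sum_i \sum_j a i j * (x' i * x' j) =
    \sum_i \sum_j a i j * (x i * x j) +
    (\sum_i \sum_j d * (e i * (a i j * x j)) +
     (\sum_i \sum_j d * (e j * (a j i * x i)) +
      \sum_i \sum_j d ^+ 2 * (e i * (e j * a i j)))).
  rewrite -!big_split /=; apply: eq_bigr => i _.
  rewrite -!big_split /=; apply: eq_bigr => j _.
  by rewrite !x'E (asym j i); ring.
have pick (F : 'I_n -> R) : \sum_i e i * F i = F i0.
  rewrite (bigD1 i0)//= /e eqxx mul1r big1 ?addr0// => i /negbTE ->.
  by rewrite mul0r.
have -> : \sum_i \sum_j d * (e i * (a i j * x j)) = d * \sum_j a i0 j * x j.
  rewrite -(pick (fun i => \sum_j a i j * x j)) mulr_sumr.
  by apply: eq_bigr => i _; rewrite !mulr_sumr.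
have -> : \sum_i \sum_j d * (e j * (a j i * x i)) = d * \sum_j a i0 j * x j.
  rewrite exchange_big -(pick (fun i => \sum_j a i j * x j)) mulr_sumr.
  by apply: eq_bigr => i _; rewrite !mulr_sumr.
have -> : \sum_i \sum_j d ^+ 2 * (e i * (e j * a i j)) = 0.
  apply: big1 => i _; rewrite -mulr_sumr.
  have -> : \sum_j e i * (e j * a i j) = e i * a i i0.
    by rewrite -mulr_sumr (pick (fun j => a i j)).
  by rewrite /e; case: eqP => [->|]; rewrite ?a0 ?mul0r ?mulr0.
by rewrite addr0; ring.
Qed.

(* A quadratic form with zero diagonal is affine in each coordinate, so
   coordinates can be rounded one at a time without decreasing it. *)
Lemma quadform_round (R : realType) (n : nat) (a : 'I_n -> 'I_n -> R)
    (x : 'I_n -> R) :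
  (forall i j, a i j = a j i) -> (forall i, a i i = 0) ->
  exists z : 'I_n -> int,
    (forall i, `|(z i)%:~R - x i| <= 1) /\
    \sum_i \sum_j a i j * (x i * x j) <=
    \sum_i \sum_j a i j * ((z i)%:~R * (z j)%:~R).
Proof.
move=> asym a0.
(* Hybrid vector: the first [m] coordinates are already rounded. *)
pose mix (m : nat) (z : 'I_n -> int) (i : 'I_n) : R :=
  if (i < m)%N then (z i)%:~R else x i.
have step (m : nat) : (m <= n)%N -> exists z : 'I_n -> int,
    (forall i, `|(z i)%:~R - x i| <= 1) /\
    \sum_i \sum_j a i j * (x i * x j) <=
    \sum_i \sum_j a i j * (mix m z i * mix m z j).
  elim: m => [_|m IH mn].
    exists (fun i => Num.floor (x i)); split => [i|].
      rewrite distrC ger0_norm ?subr_ge0 ?floor_le// lerBlDl ltW//.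
      by rewrite -{2}[1]/(1%:~R) -intrD floorD1_gt.
    by rewrite lexx.
  have [z [zx Qz]] := IH (ltnW mn); pose i0 := Ordinal mn.
  pose g := 2 * \sum_j a i0 j * mix m z j.
  (* [g] is the slope of the form in coordinate [i0]; rounding in the direction of its sign makes
     the increment nonnegative. *)
  pose s := Num.floor (x i0) + (if 0 <= g then 1 else 0).
  exists (fun i => if i == i0 then s else z i).
  have sx : `|s%:~R - x i0| <= 1 /\ 0 <= (s%:~R - x i0) * g.
    have f1 := floor_le (x i0); have f2 := ltW (floorD1_gt (x i0)).
    rewrite /s; case: ifP => g0.
      split; last by rewrite mulr_ge0// subr_ge0.
      by rewrite ger0_norm ?subr_ge0// intrD; lra.
    have g1 : g <= 0 by rewrite leNgt; apply/negP => /ltW; rewrite g0.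
    rewrite addr0; split; last by rewrite mulr_le0// subr_le0.
    by rewrite distrC ger0_norm ?subr_ge0//; move: f2; rewrite intrD; lra.
  split=> [i|]; first by case: eqP => [->|_]; [exact: sx.1|exact: zx].
  apply: (le_trans Qz).
  have := quadform_update (mix m z) i0 (s%:~R - x i0) asym a0.
  rewrite /= -/g => upd.
  have mixE i : mix m.+1 (fun i => if i == i0 then s else z i) i =
      if i == i0 then mix m z i + (s%:~R - x i0) else mix m z i.
    rewrite /mix; case: eqP => [->|/eqP ne] /=.
      by rewrite ltnS leqnn ltnn addrC subrK.
    rewrite ltnS leq_eqVlt; case: eqP => //= im; case/eqP: ne.
    exact/val_inj.
  under [leRHS]eq_bigr => i _ do under eq_bigr => j _ do rewrite !mixE.
  by rewrite upd lerDl sx.2.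
have [z [zx Qz]] := step n (leqnn n).
exists z; split=> //; apply: (le_trans Qz).
by under eq_bigr => i _ do under eq_bigr => j _ do rewrite /mix !ltn_ord.
Qed.

(** * The spectral bound, by a union bound over the grid *)

Lemma card_sum_chi (R : realType) (T I : finType) (B : {set T}) (P : pred I)
    (F : I -> {set T}) :
  (forall x, x \in B -> exists2 i, P i & x \in F i) ->
  (#|B|%:R : R) <= \sum_(i | P i) #|F i|%:R.
Proof.
move=> BF; rewrite -natr_sum ler_nat.
have sub : B \subset \bigcup_(i | P i) F i.
  by apply/fintype.subsetP => x /BF[i Pi xF]; apply/finset.bigcupP; exists i.
apply: (leq_trans (subset_leq_card sub)).
elim/big_rec2: _ => [|i m A Pi le]; first by rewrite cards0.
by rewrite (leq_trans (leq_card_setU _ _))// leq_add2l.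
Qed.

(** Sign and magnitude encode the integers of absolute value below [m] in a finite type. Zero occurs
    twice, which only enlarges the count. *)
Definition grid_val (R : realType) (m : nat) (p : bool * 'I_m) : R :=
  (-1) ^+ p.1 * p.2%:R.

Lemma geometric_ord_le (R : realType) (q : R) (m : nat) :
  0 <= q < 1 -> \sum_(i < m) q ^+ i <= (1 - q)^-1.
Proof.
move=> /andP[q0 q1]; rewrite -[leRHS]mul1r ler_pdivlMr ?subr_gt0//.
have -> : (\sum_(i < m) q ^+ i) * (1 - q) = 1 - q ^+ m.
  by rewrite mulrC -opprB mulNr -subrX1 opprB.
by rewrite lerBlDr lerDl exprn_ge0.
Qed.

(* Chernoff-style count: each admissible [v] is charged the product of
   [q ^ (|v_i| - 11)], and the total charge factors over coordinates. *)
Lemma grid_count (R : realType) (n m : nat) :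
  #|[set v : {ffun 'I_n -> bool * 'I_m} |
      (\sum_i ((v i).2 : nat) <= 11 * n)%N]|%:R <= expR ((44%:R / 10) * n%:R) :> R.
Proof.
pose q : R := 10 / 11.
have q0 : 0 < q by rewrite /q; lra.
have q1 : q < 1 by rewrite /q; lra.
apply: (@le_trans _ _ (\sum_(v : {ffun 'I_n -> bool * 'I_m})
    \prod_i (q ^- 11 * q ^+ (v i).2))).
  rewrite -sum1_card natr_sum big_mkcond /=; apply: ler_sum => v _.
  rewrite inE; case: ifP => [vn|_]; last first.
    by apply: prodr_ge0 => i _; rewrite mulr_ge0 ?invr_ge0 ?exprn_ge0// ltW.
  rewrite big_split /= prodr_const card_ord prodrXr exprVn -exprM.
  rewrite mulrC ler_pdivlMr ?exprn_gt0// mul1r.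
  by rewrite ler_wiXn2l// ltW.
rewrite -(bigA_distr_bigA (fun _ (p : bool * 'I_m) => q ^- 11 * q ^+ p.2)) /=.
rewrite prodr_const card_ord mulrC expRM_natl.
apply: lerXn2r; rewrite ?nnegrE ?expR_ge0//.
  by apply: sumr_ge0 => p _; rewrite mulr_ge0 ?invr_ge0 ?exprn_ge0// ltW.
rewrite -mulr_sumr.
have -> : \sum_(p : bool * 'I_m) q ^+ p.2 = 2 * \sum_(i < m) q ^+ i.
  rewrite -(pair_bigA _ (fun (b : bool) (i : 'I_m) => q ^+ i)) /= big_bool /=.
  by rewrite mulr_natl mulr2n.
(* The factor of one coordinate: the two signs and the geometric series give [2 / (1 - q) = 22]. The
   product [22 (11/10)^11] is below [(11/10)^44], hence below [e^(4.4)]. *)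
apply: (@le_trans _ _ (q ^- 11 * 22)).
  apply: ler_wpM2l; first by rewrite invr_ge0 exprn_ge0// ltW.
  have q11 : 1 - q = 11^-1 by rewrite /q; field.
  have -> : 22 = 2 * (1 - q)^-1 :> R by rewrite q11 invrK; ring.
  apply: ler_wpM2l => //; apply: geometric_ord_le.
  by rewrite q1 ltW.
have e1 : 11 / 10 <= expR (1 / 10) :> R.
  by apply: le_trans (expR_ge1Dx _); lra.
apply: (@le_trans _ _ ((11 / 10) ^+ 44)).
  have -> : q ^- 11 = (11 / 10) ^+ 11 by rewrite /q -exprVn invf_div.
  by lra.
have -> : 44 / 10 = 44%:R * (1 / 10) :> R by field.
rewrite expRM_natl; apply: lerXn2r => //; rewrite nnegrE ?expR_ge0//; lra.
Qed.

Lemma signed_adj_sym (R : realType) (n : nat) (E : {set {set 'I_n}}) i j :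
  signed_adj R E i j = signed_adj R E j i.
Proof. by rewrite /signed_adj eq_sym finset.setUC. Qed.

Lemma signed_adj_diag (R : realType) (n : nat) (E : {set {set 'I_n}}) i :
  signed_adj R E i i = 0.
Proof. by rewrite /signed_adj eqxx. Qed.

(** An operator norm bound. The constant 11/2 is large enough for the Chernoff exponent to beat the
    grid count and small enough to be absorbed by [k >= 10 sqrt n]. *)
Definition spectral_bound (R : realType) (n : nat) (E : {set {set 'I_n}}) : Prop :=
  forall x : 'I_n -> R,
    `|\sum_i \sum_j signed_adj R E i j * (x i * x j)| <=
    11 / 2 * Num.sqrt n%:R * \sum_i x i ^+ 2.

(** A violating vector is rescaled to squared norm [100 n], where the form exceeds [550 n sqrt n] in
    absolute value, and then rounded; [s] records the sign of the form. *)
Lemma spectral_grid (R : realType) (n : nat) (E : {set {set 'I_n}}) :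
  (0 < n)%N -> ~ spectral_bound R E ->
  exists (s : bool) (v : {ffun 'I_n -> bool * 'I_(11 * n).+1}),
    [/\ (\sum_i ((v i).2 : nat) <= 11 * n)%N,
        \sum_i grid_val R (v i) ^+ 2 <= 121 * n%:R &
        550%:R * n%:R * Num.sqrt n%:R <= \sum_i \sum_j signed_adj R E i j *
          ((-1) ^+ s * (grid_val R (v i) * grid_val R (v j)))].
Proof.
move=> n0 /existsNP[x /negP]; rewrite -ltNge => Qx.
pose Q := \sum_i \sum_j signed_adj R E i j * (x i * x j).
pose N := \sum_i x i ^+ 2.
have N0 : 0 < N.
  rewrite lt_neqAle sumr_ge0 ?andbT => [|i _]; last exact: sqr_ge0.
  apply/eqP => N0; have x0 i : x i = 0.
    apply/eqP; rewrite -sqrf_eq0; apply/eqP.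
    have /psumr_eq0P : N = 0 by [].
    by apply => // j _; exact: sqr_ge0.
  move: Qx; rewrite -/N -N0 mulr0 big1 ?normr0 ?ltxx// => i _.
  by apply: big1 => j _; rewrite x0 mul0r mulr0.
pose s := Q < 0; pose c := 10 * Num.sqrt n%:R / Num.sqrt N.
have c2 : c ^+ 2 = 100%:R * n%:R / N.
  by rewrite /c !exprMn exprVn !sqr_sqrtr ?(ltW N0)// -natrX.
pose a i j : R := (-1) ^+ s * signed_adj R E i j.
pose X i := c * x i.
have sumX : \sum_i X i ^+ 2 = 100%:R * n%:R.
  under eq_bigr do rewrite exprMn.
  by rewrite -mulr_sumr c2 divfK// gt_eqF.
have asym i j : a i j = a j i by rewrite /a signed_adj_sym.
have a0 i : a i i = 0 by rewrite /a signed_adj_diag mulr0.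
have [z [zX Qz]] := quadform_round X asym a0.
(* Weighted AM-GM, as rounding moves a coordinate by at most 1. Summed over [i] it gives
   [110 n + 11 n = 121 n]. *)
have zsq i : ((z i)%:~R : R) ^+ 2 <= 11 / 10 * X i ^+ 2 + 11.
  have := zX i; set y : R := (z i)%:~R => yX.
  have dle : (y - X i) ^+ 2 <= 1 by rewrite -real_normK ?num_real// expr_le1.
  rewrite -subr_ge0.
  have -> : 11 / 10 * X i ^+ 2 + 11 - y ^+ 2 =
    11 * (1 - (y - X i) ^+ 2) + (X i - 10 * (y - X i)) ^+ 2 / 10 by field.
  by rewrite addr_ge0 ?divr_ge0 ?sqr_ge0// mulr_ge0// subr_ge0.
have zsum : \sum_i ((z i)%:~R : R) ^+ 2 <= 121 * n%:R.
  apply: (le_trans (ler_sum _ (fun i _ => zsq i))).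
  rewrite big_split /= -mulr_sumr sumX sumr_const card_ord -(mulr_natr 11); lra.
(* From [y <= y^2 / 22 + 11 / 2], an equality at [y = 11], and the bound [121 n] on the squares. *)
have zabs : (\sum_i `|z i| <= 11 * n)%N.
  rewrite -(ler_nat R) natr_sum natrM.
  apply: (@le_trans _ _ (\sum_(i < n) (((z i)%:~R : R) ^+ 2 / 22 + 11 / 2))).
    apply: ler_sum => i _; rewrite -[_%:R]/(`|z i|%N%:~R) abszE intr_norm.
    rewrite -subr_ge0 -(real_normK (num_real (z i)%:~R)); set y := `|_|.
    have -> : y ^+ 2 / 22 + 11 / 2 - y = (y - 11) ^+ 2 / 22 by field.
    by rewrite divr_ge0// sqr_ge0.
  rewrite big_split /= -mulr_suml sumr_const card_ord -(mulr_natr (11 / 2)).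
  by lra.
exists s, [ffun i => ((z i < 0)%R, inord `|z i|%N)].
have zle i : (`|z i| <= 11 * n)%N.
  by apply: leq_trans zabs; rewrite (bigD1 i)//= leq_addr.
have gz i : grid_val R (((z i < 0)%R, inord `|z i|%N) : bool * 'I_(11 * n).+1) =
    (z i)%:~R.
  by rewrite /grid_val /= inordK ?ltnS// [in RHS](intEsign (z i)) intrM rmorphXn /= rmorphN1.
split.
- rewrite (eq_bigr (fun i => `|z i|%N)) ?zabs// => i _.
  by rewrite ffunE /= inordK ?ltnS.
- by under eq_bigr do rewrite ffunE gz.
under eq_bigr => i _ do under eq_bigr => j _ do rewrite !ffunE !gz mulrCA mulrA.
apply: le_trans Qz.
have -> : \sum_i \sum_j a i j * (X i * X j) = c ^+ 2 * `|Q|.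
  have -> : `|Q| = (-1) ^+ s * Q by rewrite /s; exact: normrEsign.
  rewrite !mulr_sumr; apply: eq_bigr => i _; rewrite !mulr_sumr.
  apply: eq_bigr => j _; rewrite /a /X.
  move: (c) ((-1) ^+ s) (signed_adj R E i j) (x i) (x j) => c0 e0 e1 e2 e3.
  ring.
rewrite c2.
have := ler_wpM2l _ (ltW Qx); rewrite -/Q -/N.
move=> /(_ (100%:R * n%:R / N)) H; apply: le_trans (H _); last first.
  by rewrite divr_ge0 ?mulr_ge0// ltW.
rewrite le_eqVlt; apply/orP; left; apply/eqP; field.
by rewrite gt_eqF.
Qed.

(** The grid with a sign has at most [2 e^(4.4 n)] points. The weights at a point form a rank-one
    matrix with squared sum at most [(121 n)^2], so each point fails with probability at most
    [e^(-5 n)]. *)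
Lemma spectral_count (R : realType) (n : nat) : (0 < n)%N ->
  #|[set E in graphs n | ~~ `[< spectral_bound R E >]]|%:R <=
  #|graphs n|%:R * (2 * expR (- (n%:R * (6 / 10)))) :> R.
Proof.
move=> n0; have n0' : 0 < n%:R :> R by rewrite ltr0n.
pose T := (bool * {ffun 'I_n -> bool * 'I_(11 * n).+1})%type.
pose grid := [set v : {ffun 'I_n -> bool * 'I_(11 * n).+1} |
  (\sum_i ((v i).2 : nat) <= 11 * n)%N].
pose P (p : T) := (p.2 \in grid) &&
  (\sum_i grid_val R (p.2 i) ^+ 2 <= 121 * n%:R).
pose w (p : T) i j : R := (-1) ^+ p.1 * (grid_val R (p.2 i) * grid_val R (p.2 j)).
pose t : R := 550%:R * n%:R * Num.sqrt n%:R.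
pose G (p : T) := [set E in graphs n |
  t <= \sum_i \sum_j signed_adj R E i j * w p i j].
apply: (@le_trans _ _ (\sum_(p | P p) #|G p|%:R)).
  apply: card_sum_chi => E; rewrite inE => /andP[Eg /asboolPn].
  move=> /(spectral_grid n0)[s [v [v1 v2 v3]]].
  by exists (s, v); [rewrite /P inE /= v1 v2|rewrite inE Eg].
apply: (@le_trans _ _ (\sum_(p | P p) #|graphs n|%:R * expR (- (n%:R * 5)))).
  apply: ler_sum => p /andP[_ p2].
  pose V : R := (121 * n%:R) ^+ 2.
  have V0 : 0 < V by rewrite /V exprn_gt0 ?mulr_gt0 ?ltr0n.
  have t0 : 0 <= t by rewrite /t mulr_ge0 ?sqrtr_ge0 ?mulr_ge0 ?ler0n.
  apply: (le_trans (signed_adj_chernoff (w := w p) V0 _ t0)).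
    have -> : \sum_i \sum_j w p i j ^+ 2 = (\sum_i grid_val R (p.2 i) ^+ 2) ^+ 2.
      rewrite expr2 mulr_suml; apply: eq_bigr => i _; rewrite mulr_sumr.
      by apply: eq_bigr => j _; rewrite /w exprMn sqrr_sign mul1r exprMn.
    rewrite ler_pXn2r ?nnegrE ?mulr_ge0 ?ler0n//; apply: sumr_ge0 => i _.
    exact: sqr_ge0.
  rewrite ler_wpM2l// ler_expR lerN2.
  have -> : t ^+ 2 / (4 * V) = n%:R * (302500%:R / 58564%:R).
    rewrite /t /V exprMn sqr_sqrtr//; field; by rewrite (gt_eqF n0').
  by rewrite ler_pM2l//; lra.
rewrite sumr_const -[leLHS]mulr_natl mulrCA ler_wpM2l//.
have cP : (#|[pred p | P p]| <= 2 * #|grid|)%N.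
  apply: (@leq_trans #|finset.setX [set: bool]%SET grid|); last first.
    by rewrite cardsX cardsT card_bool.
  apply/subset_leq_card/fintype.subsetP => -[b v].
  by move=> /andP[vg _]; rewrite finset.in_setX finset.in_setT vg.
apply: (@le_trans _ _ (2 * expR (44 / 10 * n%:R) * expR (- (n%:R * 5)))).
  rewrite ler_wpM2r ?expR_ge0//.
  apply: (@le_trans _ _ (2 * #|grid|)%N%:R); first by rewrite ler_nat.
  by rewrite natrM ler_pM2l// grid_count.
rewrite -mulrA -expRD ler_pM2l// ler_expR; lra.
Qed.

(** * Few atypical vertices for every planted set *)

Lemma bin_le_exp (n k : nat) : ('C(n, k) <= n ^ k)%N.
Proof.
have h : (n ^_ k <= n ^ k)%N.
  rewrite ffact_prod; apply: (@leq_trans (\prod_(i < k) n)).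
    by apply: leq_prod => i _; exact: leq_subr.
  by rewrite prod_nat_const card_ord.
by apply: leq_trans h; rewrite -bin_ffact leq_pmulr// fact_gt0.
Qed.

Lemma exists_subset_card (T : finType) (A : {set T}) (b : nat) :
  (b <= #|A|)%N -> exists2 B : {set T}, B \subset A & #|B| = b.
Proof.
move=> bA; exists [set x in take b (enum A)].
  apply/fintype.subsetP => x; rewrite inE => /mem_take.
  by rewrite mem_enum.
rewrite cardsE (card_uniqP _); first by rewrite size_takel// -cardE.
by rewrite take_uniq// enum_uniq.
Qed.

(** The threshold [k / 10] keeps the reweighting factor [k / (k - t_i)] of every other vertex
    outside [K] at most 10/9. *)
Definition atypical (R : realType) (n : nat) (E : {set {set 'I_n}})
  (K : {set 'I_n}) : {set 'I_n} :=
  [set i | (i \notin K) && (#|K|%:R / 10 < \sum_(j in K) signed_adj R E i j)].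

(** Keep exactly [b] atypical vertices [B]: the entries over [B] times [K] then sum to at least
    [b k / 10]. Chernoff with [V = b k] gives the exponential, and [n ^ (k + b)] bounds the choices
    of [K] and [B]. *)
Lemma atypical_count (R : realType) (n k b : nat) : (0 < k)%N -> (0 < b)%N ->
  #|[set E in graphs n |
      [exists K : {set 'I_n}, (#|K| == k) && (b <= #|atypical R E K|)%N]]|%:R
  <= #|graphs n|%:R * (n%:R ^+ (k + b) * expR (- (b%:R * k%:R / 400%:R))) :> R.
Proof.
move=> k0 b0.
pose w (p : {set 'I_n} * {set 'I_n}) (i j : 'I_n) : R :=
  ((i \in p.2) && (j \in p.1))%:R.
have wsum (F : 'I_n -> 'I_n -> R) p :
    \sum_i \sum_j F i j * w p i j = \sum_(i in p.2) \sum_(j in p.1) F i j.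
  rewrite [RHS]big_mkcond /=; apply: eq_bigr => i _; rewrite /w.
  case: (i \in p.2) => /=; last by apply: big1 => j _; rewrite mulr0.
  rewrite [RHS]big_mkcond /=; apply: eq_bigr => j _.
  by case: (j \in p.1); rewrite ?mulr1 ?mulr0.
have bk0 : 0 < b%:R * k%:R :> R by rewrite mulr_gt0 ?ltr0n.
pose G p := [set E in graphs n |
  b%:R * k%:R / 10 <= \sum_i \sum_j signed_adj R E i j * w p i j].
pose P (p : {set 'I_n} * {set 'I_n}) := (#|p.1| == k) && (#|p.2| == b).
apply: (@le_trans _ _ (\sum_(p | P p) #|G p|%:R)).
  apply: card_sum_chi => E; rewrite inE => /andP[Eg /existsP[K /andP[/eqP Kk]]].
  move=> /exists_subset_card[B /fintype.subsetP BA Bb].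
  exists (K, B); first by rewrite /P /= Kk Bb !eqxx.
  rewrite inE Eg /= wsum /= -mulrA -Bb -sum1_card natr_sum mulr_suml.
  apply: ler_sum => i /BA; rewrite inE => /andP[_ /ltW].
  by rewrite Kk mul1r.
apply: (@le_trans _ _ (\sum_(p | P p)
    #|graphs n|%:R * expR (- (b%:R * k%:R / 400%:R)))).
  apply: ler_sum => p /andP[/eqP pk /eqP pb].
  have -> : b%:R * k%:R / 400%:R =
      (b%:R * k%:R / 10) ^+ 2 / (4 * (b%:R * k%:R)) :> R.
    by field; rewrite !pnatr_eq0 -!lt0n k0 b0.
  apply: signed_adj_chernoff => //.
  under eq_bigr => i _ do under eq_bigr => j _ do rewrite expr2.
  rewrite wsum.
  rewrite le_eqVlt; apply/orP; left; apply/eqP.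
  transitivity (\sum_(i in p.2) \sum_(j in p.1) (1 : R)).
    by apply: eq_bigr => i ip; apply: eq_bigr => j jp; rewrite /w ip jp.
  by rewrite !sumr_const pk pb -mulrnA mulnC natrM.
rewrite sumr_const -[leLHS]mulr_natl mulrCA ler_wpM2l// ler_wpM2r ?expR_ge0//.
rewrite -natrX ler_nat.
have -> : #|[pred p | P p]| = (#|[set K : {set 'I_n} | #|K| == k]| *
    #|[set B : {set 'I_n} | #|B| == b]|)%N.
  rewrite -cardsX; apply: eq_card => -[K B].
  by rewrite !inE.
by rewrite !card_draws card_ord expnD leq_mul// bin_le_exp.
Qed.

(** * Weak duality for the theta function *)

Lemma dotvE (R : realType) (n : nat) (u v : 'rV[R]_n) :
  dotv u v = \sum_j u 0 j * v 0 j.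
Proof. by rewrite /dotv mxE; apply: eq_bigr => j _; rewrite mxE. Qed.

(** The component of [v] orthogonal to [h] has nonnegative squared norm. *)
Lemma dotv_cauchy (R : realType) (n : nat) (h v : 'rV[R]_n) :
  dotv h h = 1 -> dotv h v ^+ 2 <= dotv v v.
Proof.
move=> h1; set c := dotv h v.
have : 0 <= dotv (v - c *: h) (v - c *: h).
  by rewrite dotvE; apply: sumr_ge0 => j _; rewrite -expr2 sqr_ge0.
have -> : dotv (v - c *: h) (v - c *: h) =
    dotv v v - 2 * c * dotv h v + c ^+ 2 * dotv h h.
  rewrite !dotvE !mulr_sumr -sumrB -big_split /=.
  by apply: eq_bigr => j _; rewrite !mxE; ring.
by rewrite h1 -/c mulr1 -mulrA -expr2; lra.
Qed.

Lemma dotv_delta (R : realType) (n : nat) (i j : 'I_n) :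
  dotv (delta_mx 0 i : 'rV[R]_n) (delta_mx 0 j) = (i == j)%:R.
Proof.
rewrite dotvE (bigD1 i)//= big1 => [|l /negbTE li].
  by rewrite !mxE !eqxx mul1r addr0.
by rewrite !mxE li mul0r.
Qed.

(* Weak duality: [M] may be chosen freely on the edges, where the products
   [dotv (s i) (s j)] vanish. *)
Lemma ortho_rep_sum_le (R : realType) (n : nat) (E : {set {set 'I_n}})
    (h : 'rV[R]_n) (s : 'I_n -> 'rV[R]_n) (U : {set 'I_n})
    (M : 'I_n -> 'I_n -> R) (l : R) :
  0 <= l -> dotv h h = 1 -> ortho_rep E s ->
  (forall i j, i \in U -> j \in U ->
     (i == j) || ([set i; j] \notin E) -> M i j = 1) ->
  (forall y : 'I_n -> R, (forall i, i \notin U -> y i = 0) ->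
     \sum_i \sum_j M i j * (y i * y j) <= l * \sum_i y i ^+ 2) ->
  \sum_(i in U) dotv h (s i) ^+ 2 <= l.
Proof.
move=> l0 h1 [s1 s0] M1 Ml.
pose x i := if i \in U then dotv h (s i) else 0.
pose S := \sum_i x i ^+ 2.
have -> : \sum_(i in U) dotv h (s i) ^+ 2 = S.
  rewrite big_mkcond /=; apply: eq_bigr => i _; rewrite /x.
  by case: ifP => // _; rewrite expr0n.
(* The test vector: [h . v = S] and [|v|^2 <= l S], so Cauchy-Schwarz gives [S^2 <= l S], and [S]
   cancels unless it is zero. *)
pose v := \sum_i x i *: s i.
have vE c : v 0 c = \sum_i x i * s i 0 c.
  by rewrite /v summxE; apply: eq_bigr => i _; rewrite mxE.
have hv : dotv h v = S.
  rewrite dotvE; under eq_bigr => c _ do rewrite vE mulr_sumr.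
  rewrite exchange_big /=; apply: eq_bigr => i _.
  rewrite /x; case: ifP => iU; last first.
    by rewrite expr0n /= big1 // => c _; rewrite mul0r mulr0.
  by rewrite expr2 {3}dotvE mulr_sumr; apply: eq_bigr => c _; ring.
have vv : dotv v v <= l * S.
  have -> : dotv v v = \sum_c \sum_i \sum_j M i j * ((x i * s i 0 c) * (x j * s j 0 c)).
    rewrite dotvE.
    transitivity (\sum_i \sum_j x i * x j * dotv (s i) (s j)).
      under eq_bigr => c _ do rewrite vE mulr_suml.
      rewrite exchange_big /=; apply: eq_bigr => i _.
      under eq_bigr => c _ do rewrite mulr_sumr.
      rewrite exchange_big /=; apply: eq_bigr => j _.
      by rewrite dotvE mulr_sumr; apply: eq_bigr => c _; ring.
    rewrite [RHS]exchange_big /=; apply: eq_bigr => i _.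
    rewrite [RHS]exchange_big /=; apply: eq_bigr => j _.
    transitivity (M i j * (x i * x j * dotv (s i) (s j))); last first.
      by rewrite dotvE !mulr_sumr; apply: eq_bigr => c _; ring.
    rewrite /x; case: ifP => iU; last by rewrite !mul0r mulr0.
    case: ifP => jU; last by rewrite mulr0 mul0r mulr0.
    case: (boolP ((i == j) || ([set i; j] \notin E))) => [ok|].
      by rewrite (M1 i j iU jU ok) mul1r.
    rewrite negb_or negbK => /andP[ij eij].
    by rewrite s0// !mulr0.
  (* The bound on the form of [M] is applied separately in each coordinate [c] of the
     representation. *)
  apply: (@le_trans _ _ (\sum_c l * \sum_i (x i * s i 0 c) ^+ 2)).
    apply: ler_sum => c _; apply: Ml => i iU.
    by rewrite /x (negbTE iU) mul0r.
  rewrite -mulr_sumr exchange_big /= le_eqVlt; apply/orP; left; apply/eqP.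
  congr (_ * _); apply: eq_bigr => i _.
  under eq_bigr => c _ do rewrite exprMn.
  rewrite -mulr_sumr -[RHS]mulr1 -(s1 i) dotvE; congr (_ * _).
have S0 : 0 <= S by apply: sumr_ge0 => i _; exact: sqr_ge0.
have := le_trans (dotv_cauchy v h1) vv; rewrite hv.
move: S0; rewrite le_eqVlt => /predU1P[<- //|S0].
by rewrite expr2 ler_pM2r.
Qed.

(** * The dual matrix for the planted clique *)

(** Polarisation: subtract the form at [r p - w] from the form at [r p + w]. The free [r] balances
    the two norms. *)
Lemma spectral_bilinear (R : realType) (n : nat) (E : {set {set 'I_n}})
    (p w : 'I_n -> R) (r : R) :
  spectral_bound R E -> 0 < r ->
  2 * \sum_i \sum_j signed_adj R E i j * (p i * w j) <=
  11 / 2 * Num.sqrt n%:R * (r * \sum_i p i ^+ 2 + (\sum_i w i ^+ 2) / r).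
Proof.
move=> sb r0; set a := 11 / 2 * _.
have h1 := sb (fun i => r * p i + w i); have h2 := sb (fun i => r * p i - w i).
rewrite -/a in h1 h2.
move: h1 h2; rewrite !ler_norml => /andP[_ h1] /andP[h2 _].
have := lerB h1 h2; set B := \sum_i \sum_j _ * (p i * w j).
set P := \sum_i p i ^+ 2; set W := \sum_i w i ^+ 2.
rewrite -sumrB.
have -> : \sum_i (\sum_j signed_adj R E i j * ((r * p i + w i) * (r * p j + w j)) -
    \sum_j signed_adj R E i j * ((r * p i - w i) * (r * p j - w j))) = 4 * r * B.
  pose F i j := signed_adj R E i j * (p i * w j).
  transitivity (2 * r * B + 2 * r * \sum_i \sum_j F j i); last first.
    rewrite exchange_big /= -/B; ring.
  rewrite /B !mulr_sumr -big_split /=; apply: eq_bigr => i _.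
  rewrite !mulr_sumr -sumrB -big_split /=; apply: eq_bigr => j _.
  by rewrite /F (signed_adj_sym _ E j i); ring.
rewrite opprK -mulrDr -big_split /=.
have -> : \sum_i ((r * p i + w i) ^+ 2 + (r * p i - w i) ^+ 2) =
    2 * r * (r * P + W / r).
  have -> : 2 * r * (r * P + W / r) = 2 * r ^+ 2 * P + 2 * W.
    by field; rewrite gt_eqF.
  by rewrite !mulr_sumr -big_split /=; apply: eq_bigr => i _; ring.
move=> h; rewrite -(ler_pM2l (_ : 0 < 2 * r)) ?mulr_gt0//.
have -> : 2 * r * (2 * B) = 4 * r * B by ring.
by apply: (le_trans h); rewrite mulrCA.
Qed.

Lemma planted_sum_le (R : realType) (n k : nat) (E : {set {set 'I_n}})
    (K : {set 'I_n}) (h : 'rV[R]_n) (s : 'I_n -> 'rV[R]_n) :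
  spectral_bound R E -> #|K| = k -> 10 * Num.sqrt n%:R <= k%:R :> R ->
  10 <= Num.sqrt n%:R :> R ->
  dotv h h = 1 -> ortho_rep (compl_graph (add_clique E K)) s ->
  \sum_(i in ~: atypical R E K) dotv h (s i) ^+ 2 <= k%:R.
Proof.
move=> sb Kk kq q10 h1 os; set q : R := Num.sqrt n%:R in kq q10.
set U := ~: atypical R E K; pose A := signed_adj R E.
have k0 : 0 < k%:R :> R by lra.
pose t i := \sum_(j in K) A i j.
have tU i : i \in U -> i \notin K -> t i <= k%:R / 10.
  by rewrite !inE Kk => + iK; rewrite iK /= -leNgt.
have kt i : i \in U -> i \notin K -> 9 / 10 * k%:R <= k%:R - t i.
  by move=> iU iK; have := tU i iU iK; lra.
(* An affine change of the entries that fixes the value 1 and makes row [i] sum to zero over [K]. *)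
pose W i j := (k%:R * A i j - t i) / (k%:R - t i).
pose M i j := if i \in K then (if j \in K then 1 else W j i)
  else if j \in K then W i j else (i == j)%:R + A i j.
have W1 i j : i \in U -> i \notin K -> A i j = 1 -> W i j = 1.
  move=> iU iK Aij; rewrite /W Aij mulr1 divff// gt_eqF//.
  by have := kt i iU iK; lra.
apply: (ortho_rep_sum_le (M := M) (ltW k0) h1 os).
  move=> i j iU jU; rewrite /M; case: eqP => [<- _|/eqP ij /= eij].
    by case: (i \in K) => //; rewrite /A signed_adj_diag addr0.
  (* A non-edge of the complement is an edge of the planted graph; unless both ends lie in [K], it
     was already present in [E]. *)
  have AK : ~~ ((i \in K) && (j \in K)) -> A i j = 1.
    move=> nK; move: eij; rewrite /compl_graph /add_clique !inE cards2 ij /= andbT.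
    rewrite negbK => /orP[eE|]; first by rewrite /A /signed_adj (negbTE ij) eE.
    by rewrite finset.subUset !finset.sub1set (negbTE nK).
  have Aji : A j i = A i j by rewrite /A signed_adj_sym.
  case: ifP AK => iK AK; case: ifP AK => jK AK //.
  - by rewrite W1 ?jK// Aji AK.
  - by rewrite W1 ?iK// AK.
  - by rewrite add0r AK.
move=> y yU.
(* Split [y] into [u] outside [K] and [v] on [K]; [w] is [v] projected orthogonally to the indicator
   of [K], and [p] is [u] scaled by the reweighting factors. *)
pose u i := if i \in K then 0 else y i.
pose v i := if i \in K then y i else 0.
pose sg := \sum_i v i.
pose w j := v j - sg / k%:R * (j \in K)%:R.
pose p i := k%:R / (k%:R - t i) * u i.
have -> : \sum_i \sum_j M i j * (y i * y j) =
    sg ^+ 2 + \sum_i u i ^+ 2 + \sum_i \sum_j A i j * (u i * u j) +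
    2 * \sum_i u i * \sum_j W i j * v j.
  pose F i j := u i * (W i j * v j).
  have -> : 2 * \sum_i u i * \sum_j W i j * v j =
      \sum_i \sum_j F i j + \sum_i \sum_j F j i.
    have FE : \sum_i u i * \sum_j W i j * v j = \sum_i \sum_j F i j.
      by apply: eq_bigr => i _; rewrite mulr_sumr.
    by rewrite FE [X in _ = _ + X]exchange_big mulr_natl mulr2n.
  have -> : sg ^+ 2 = \sum_i \sum_j v i * v j.
    by rewrite expr2 mulr_suml; apply: eq_bigr => i _; rewrite mulr_sumr.
  have -> : \sum_i u i ^+ 2 = \sum_i \sum_j (i == j)%:R * (u i * u j).
    apply: eq_bigr => i _; rewrite (bigD1 i)//= eqxx mul1r big1 ?addr0//.
    by move=> j /negbTE ji; rewrite eq_sym ji mul0r.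
  rewrite -!big_split /=; apply: eq_bigr => i _.
  rewrite -!big_split /=; apply: eq_bigr => j _.
  by rewrite /M /F /u /v; case: (i \in K); case: (j \in K); ring.
(* The projection moves from the rows of [W] onto [v], so that the spectral bound for [A] itself
   applies. *)
have -> : \sum_i u i * \sum_j W i j * v j =
    \sum_i \sum_j A i j * (p i * w j).
  apply: eq_bigr => i _.
  case: (boolP ((i \in K) || (i \notin U))) => [iKU|].
    have ui0 : u i = 0.
      by rewrite /u; case/orP: iKU => [->//|/yU ->]; case: ifP.
    by rewrite ui0 mul0r big1// => j _; rewrite /p ui0 mulr0 mul0r mulr0.
  rewrite negb_or negbK => /andP[iK iU].
  have kt0 : k%:R - t i != 0 by rewrite gt_eqF//; have := kt i iU iK; lra.
  have -> : \sum_j W i j * v j =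
      (k%:R * (\sum_j A i j * v j) - t i * sg) / (k%:R - t i).
    rewrite /sg !mulr_sumr -sumrB mulr_suml; apply: eq_bigr => j _.
    by rewrite /W; ring.
  have -> : \sum_j A i j * (p i * w j) = p i * (\sum_j A i j * v j - sg / k%:R * t i).
    have -> : t i = \sum_j A i j * (j \in K)%:R.
      rewrite /t big_mkcond /=; apply: eq_bigr => j _.
      by case: (j \in K); rewrite ?mulr1 ?mulr0.
    by rewrite mulr_sumr -sumrB mulr_sumr; apply: eq_bigr => j _; rewrite /w; ring.
  rewrite /p; move: (t i) (\sum_j _) kt0 => ti z kt0; field.
  by rewrite kt0 gt_eqF.
have u2 : 0 <= \sum_i u i ^+ 2 by apply: sumr_ge0 => i _; exact: sqr_ge0.
have uu : \sum_i \sum_j A i j * (u i * u j) <= 11 / 2 * q * \sum_i u i ^+ 2.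
  by apply: le_trans (sb u); exact: ler_norm.
have p2 : \sum_i p i ^+ 2 <= 100%:R / 81%:R * \sum_i u i ^+ 2.
  rewrite mulr_sumr; apply: ler_sum => i _; rewrite /p exprMn.
  case: (boolP ((i \in K) || (i \notin U))) => [iKU|].
    have ui0 : u i = 0.
      by rewrite /u; case/orP: iKU => [->//|/yU ->]; case: ifP.
    by rewrite ui0 expr0n /= !mulr0.
  rewrite negb_or negbK => /andP[iK iU]; rewrite ler_wpM2r ?sqr_ge0//.
  have kti := kt i iU iK.
  have -> : 100%:R / 81%:R = (10 / 9) ^+ 2 :> R by field.
  have kt0 : 0 < k%:R - t i by lra.
  apply: lerXn2r; rewrite ?nnegrE; first by rewrite divr_ge0 ?ltW.
    by lra.
  by rewrite ler_pdivrMr//; lra.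
have w2 : \sum_i w i ^+ 2 = \sum_i v i ^+ 2 - sg ^+ 2 / k%:R.
  transitivity (\sum_i (v i ^+ 2 - 2 * (sg / k%:R) * v i +
      (sg / k%:R) ^+ 2 * (i \in K)%:R)).
    by apply: eq_bigr => i _; rewrite /w /v; case: (i \in K) => /=; move: (sg / _) => sk; rewrite ?mulr1n ?mulr0n; ring.
  rewrite big_split sumrB /= -!mulr_sumr -/sg.
  have -> : \sum_i (i \in K)%:R = k%:R :> R.
    by rewrite -Kk -sum1_card natr_sum [RHS]big_mkcond /=; apply: eq_bigr => i _; case: (i \in K).
  by field; rewrite gt_eqF.
have w20 : 0 <= \sum_i w i ^+ 2 by apply: sumr_ge0 => i _; exact: sqr_ge0.
have y2 : \sum_i y i ^+ 2 = \sum_i u i ^+ 2 + \sum_i v i ^+ 2.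
  rewrite -big_split /=; apply: eq_bigr => i _; rewrite /u /v.
  by case: (i \in K); rewrite expr0n /= ?addr0 ?add0r.
(* With this [r], in units of [q], the coefficient of [|u|^2] is about [0.1 + 5.5 + 3.81] and that
   of [|w|^2] about [9.83]; both stay below 10. *)
have r0 : 0 < 14 / 25 :> R by lra.
have := spectral_bilinear p w sb r0; rewrite -/q -/A y2.
set B := 2 * _; set Q := \sum_i \sum_j _ in uu *.
move: uu p2 w2 w20 u2; move: (\sum_i u i ^+ 2) (\sum_i v i ^+ 2).
move: (\sum_i p i ^+ 2) (\sum_i w i ^+ 2) => p2 w2 u2 v2 uu pu wv w0 u0 bil.
have sv : sg ^+ 2 + k%:R * w2 = k%:R * v2 by rewrite wv; field; rewrite gt_eqF.
have q0 : 0 < q by lra.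
have i1 : q * p2 <= q * (100%:R / 81%:R * u2) by rewrite ler_wpM2l// ltW.
have i2 : 10 * q * w2 <= k%:R * w2 by rewrite ler_wpM2r.
have i3 : 10 * q * u2 <= k%:R * u2 by rewrite ler_wpM2r.
have i4 : 10 * u2 <= q * u2 by rewrite ler_wpM2r.
have i5 : 0 <= q * w2 by rewrite mulr_ge0// ltW.
rewrite mulrDr -sv.
have bil' : B <= 11 / 2 * (14 / 25) * (q * p2) + 11 / 2 * (25%:R / 14) * (q * w2).
  apply: (le_trans bil); rewrite le_eqVlt; apply/orP; left; apply/eqP; by field.
by lra.
Qed.

(** * Lower and upper bounds on theta *)

Lemma ortho_rep_delta (R : realType) (n : nat) (E : {set {set 'I_n}}) :
  ortho_rep E (fun i => delta_mx 0 i : 'rV[R]_n).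
Proof.
split=> [i|i j /negbTE ij _]; rewrite dotv_delta ?eqxx//.
by rewrite ij.
Qed.

Lemma theta_le (R : realType) (n : nat) (E : {set {set 'I_n}}) (B : R) :
  (0 < n)%N ->
  (forall (h : 'rV[R]_n) s, dotv h h = 1 -> ortho_rep E s ->
     \sum_i dotv h (s i) ^+ 2 <= B) ->
  theta R E <= B.
Proof.
move=> n0 hB; apply: ge_sup; last by move=> _ [h [s [h1 os ->]]]; exact: hB.
pose h : 'rV[R]_n := delta_mx 0 (Ordinal n0).
exists (\sum_(i < n) dotv h (delta_mx 0 i) ^+ 2).
exists h, (fun i => delta_mx 0 i); split=> //; last exact: ortho_rep_delta.
by rewrite dotv_delta eqxx.
Qed.

Lemma ortho_rep_sqr_le1 (R : realType) (n : nat) (E : {set {set 'I_n}})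
    (h : 'rV[R]_n) s i :
  dotv h h = 1 -> ortho_rep E s -> dotv h (s i) ^+ 2 <= 1.
Proof. by move=> h1 [s1 _]; rewrite -(s1 i) dotv_cauchy. Qed.

Lemma ortho_rep_sum_le_card (R : realType) (n : nat) (E : {set {set 'I_n}})
    (h : 'rV[R]_n) s (A : {set 'I_n}) :
  dotv h h = 1 -> ortho_rep E s ->
  \sum_(i in A) dotv h (s i) ^+ 2 <= #|A|%:R.
Proof.
move=> h1 os; rewrite -sum1_card natr_sum; apply: ler_sum => i _.
exact: ortho_rep_sqr_le1 os.
Qed.

Lemma theta_le_order (R : realType) (n : nat) (E : {set {set 'I_n}}) :
  (0 < n)%N -> theta R E <= n%:R.
Proof.
move=> n0; apply: theta_le => // h s h1 os.
have := ortho_rep_sum_le_card [set: 'I_n]%SET h1 os.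
by rewrite cardsT card_ord big_mkcond; under eq_bigr do rewrite finset.in_setT.
Qed.

Lemma theta_ge_planted (R : realType) (n : nat) (E : {set {set 'I_n}})
    (K : {set 'I_n}) :
  (0 < #|K|)%N -> #|K|%:R <= theta R (compl_graph (add_clique E K)).
Proof.
move=> /card_gt0P[i0 i0K].
apply: ub_le_sup.
  exists n%:R => _ [h [s [h1 os ->]]].
  have := ortho_rep_sum_le_card [set: 'I_n]%SET h1 os.
  by rewrite cardsT card_ord big_mkcond; under eq_bigr do rewrite finset.in_setT.
(* [K] is independent in the complement, so all its vertices may share one basis vector, which is
   also taken as [h]. *)
pose f i := if i \in K then i0 else i.
exists (delta_mx 0 i0), (fun i => delta_mx 0 (f i)); split.
- by rewrite dotv_delta eqxx.
- split=> [i|i j ij]; first by rewrite dotv_delta eqxx.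
  rewrite /compl_graph /add_clique !inE cards2 ij /= andbT negb_or => /andP[_ nK].
  rewrite dotv_delta /f; case: ifP => iK; case: ifP => jK.
  + by move: nK; rewrite finset.subUset !finset.sub1set iK jK.
  + by case: eqP => // e; rewrite -e i0K in jK.
  + by case: eqP => // e; rewrite e i0K in iK.
  + by rewrite (negbTE ij).
rewrite -sum1_card natr_sum big_mkcond /=; apply: eq_bigr => i _.
rewrite dotv_delta /f; case: ifP => [_|iK]; first by rewrite eqxx expr1n.
by case: eqP => [e|_]; [rewrite -e i0K in iK|rewrite expr0n].
Qed.

Lemma theta_planted_le (R : realType) (n : nat) (E : {set {set 'I_n}})
    (K : {set 'I_n}) :
  (0 < n)%N -> spectral_bound R E ->
  10 * Num.sqrt n%:R <= #|K|%:R :> R -> 10 <= Num.sqrt n%:R :> R ->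
  theta R (compl_graph (add_clique E K)) <= #|K|%:R + #|atypical R E K|%:R.
Proof.
move=> n0 sb Kq q10; apply: theta_le => // h s h1 os.
rewrite (bigID (fun i => i \in ~: atypical R E K)%SET) /=; apply: lerD.
  exact: planted_sum_le os.
under eq_bigl => i do rewrite finset.in_setC negbK.
exact: ortho_rep_sum_le_card os.
Qed.

(** * Failure probability and choice of constants *)

Lemma prob_gnp_ge (R : realType) (n : nat) (P : {set {set 'I_n}} -> bool) (x : R) :
  #|[set E in graphs n | ~~ P E]|%:R <= #|graphs n|%:R * x ->
  1 - x <= prob_gnp R P.
Proof.
have g0 : 0 < #|graphs n|%:R :> R.
  by rewrite ltr0n; apply/card_gt0P; exists finset.set0; rewrite powersetE finset.sub0set.
move=> h; rewrite /prob_gnp ler_pdivlMr// mulrBl mul1r lerBlDr.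
apply: (@le_trans _ _
  (#|[set E in graphs n | P E]|%:R + #|[set E in graphs n | ~~ P E]|%:R)).
  rewrite -natrD ler_nat -(cardsID [set E | P E]%SET (graphs n)).
  apply: leq_add; apply: subset_leq_card; apply/fintype.subsetP => E.
    by rewrite !inE.
  by rewrite !inE andbC.
by rewrite lerD2l mulrC.
Qed.

(* The exponents balance because [b >= 800 ln n] pays for the choice of [K]
   and [k >= 1600 ln n] pays for the choice of the atypical vertices. *)
Lemma failure_le (R : realType) (n k b : nat) (c q : R) :
  q = Num.sqrt n%:R -> 640 <= c -> c ^+ 4 <= n%:R -> 10 * q <= k%:R ->
  800 <= b%:R :> R -> 800 * ln n%:R <= b%:R :> R ->
  2 * expR (- (n%:R * (6 / 10))) +
    n%:R ^+ (k + b) * expR (- (b%:R * k%:R / 400)) <= expR (- q).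
Proof.
move=> qE c640 nc kq b800 bL.
have c0 : 0 < c by lra.
have n0 : 0 < n%:R :> R by apply: lt_le_trans nc; rewrite exprn_gt0.
have qn : n%:R = q ^+ 2 by rewrite qE sqr_sqrtr// ltW.
have q0 : 0 < q by rewrite qE sqrtr_gt0.
(* [s] is the fourth root of [n], so [ln n <= 4 s]; with [s >= 640] this yields
   [k >= 10 s^2 >= 6400 s >= 1600 ln n]. *)
pose s := Num.sqrt q.
have s0 : 0 < s by rewrite sqrtr_gt0.
have sq : q = s ^+ 2 by rewrite sqr_sqrtr// ltW.
have sc : c <= s.
  rewrite leNgt; apply/negP => sc; move: nc; rewrite qn sq -exprM leNgt.
  by rewrite ltr_pXn2r ?sc// nnegrE ltW.
have s640 : 640 <= s by lra.
have Ls : ln n%:R <= 4 * s.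
  rewrite qn sq -exprM lnXn// -[leLHS]mulr_natl; apply: ler_wpM2l => //.
  exact/ltW/ln_sublinear.
have ss : 640 * s <= q by rewrite sq expr2 ler_wpM2r// ltW.
have q10 : 10 <= q by lra.
have e1 : 2 <= expR 1 :> R by apply: le_trans (expR_ge1Dx _); lra.
have e3 : 4 <= expR 3 :> R by apply: le_trans (expR_ge1Dx _); lra.
(* Each of the two failure terms is made at most half of [e^(-q)]. *)
have h1 : expR (- (n%:R * (6 / 10))) * 4 <= expR (- q).
  apply: (@le_trans _ _ (expR (- (n%:R * (6 / 10))) * expR 3)).
    by rewrite ler_wpM2l ?expR_ge0.
  rewrite -expRD ler_expR qn.
  have : 10 * q <= q ^+ 2 by rewrite expr2 ler_wpM2r// ltW.
  by lra.
have h2 : n%:R ^+ (k + b) * expR (- (b%:R * k%:R / 400)) * 2 <= expR (- q).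
  have -> : n%:R ^+ (k + b) = expR ((k + b)%:R * ln n%:R) :> R.
    by rewrite expRM_natl lnK// posrE.
  apply: (@le_trans _ _ (expR ((k + b)%:R * ln n%:R) *
      expR (- (b%:R * k%:R / 400)) * expR 1)).
    by apply: ler_wpM2l e1; rewrite mulr_ge0 ?expR_ge0.
  rewrite -!expRD ler_expR natrD.
  have k1600 : 1600 * ln n%:R <= k%:R :> R by lra.
  have i1 : k%:R * (800 * ln n%:R) <= k%:R * b%:R :> R by rewrite ler_wpM2l.
  have i2 : b%:R * (1600 * ln n%:R) <= b%:R * k%:R :> R by rewrite ler_wpM2l.
  have i3 : 800 * k%:R <= b%:R * k%:R :> R by rewrite ler_wpM2r.
  by move: i1 i2 i3 kq q10; clear; lra.
by lra.
Qed.

Lemma log2_bounds (R : realType) (x : R) : 2 <= x ->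
  1 <= log2 x /\ ln x <= log2 x.
Proof.
move=> x2; have ln20 : 0 < ln 2 :> R by rewrite ln_gt0//; lra.
have ln21 : ln 2 <= 1 :> R by apply: (@le_ln1Dx R 1); lra.
have ln2x : ln 2 <= ln x by rewrite ler_ln// posrE; lra.
rewrite /log2; split; first by rewrite ler_pdivlMr// mul1r.
by rewrite ler_pdivlMr// ler_piMr// (le_trans (ltW ln20)).
Qed.

(** If the spectral bound holds and theta still exceeds [k + b] for some [K], that [K] has more than
    [b] atypical vertices; the two counts add up. *)
Lemma planted_failure_count (R : realType) (n k b : nat) :
  (0 < n)%N -> (0 < k)%N -> (0 < b)%N ->
  10 * Num.sqrt n%:R <= k%:R :> R -> 10 <= Num.sqrt n%:R :> R ->
  #|[set E in graphs n | ~~ [forall K : {set 'I_n}, (#|K| == k) ==>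
      (theta R (compl_graph (add_clique E K)) <= k%:R + b%:R)]]|%:R <=
  #|graphs n|%:R * (2 * expR (- (n%:R * (6 / 10))) +
    n%:R ^+ (k + b) * expR (- (b%:R * k%:R / 400%:R))) :> R.
Proof.
move=> n0 k0 b0 kq q10; rewrite mulrDr.
apply: le_trans (lerD (spectral_count R n0) (atypical_count R n k0 b0)).
rewrite -[leRHS]natrD ler_nat; apply: leq_trans (leq_card_setU _ _).
apply/subset_leq_card/fintype.subsetP => E.
rewrite !inE => /andP[-> /forallPn[K]]; rewrite negb_imply /= => /andP[/eqP Kk thE].
case: asboolP => //= sb; apply/existsP; exists K; rewrite Kk eqxx /=.
apply: contraNT thE; rewrite -ltnNge => /ltnW aK.
have := theta_planted_le (K := K) n0 sb; rewrite Kk => /(_ kq q10) h.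
by apply: (le_trans h); rewrite lerD2l ler_nat.
Qed.

Unset Implicit Arguments.

Theorem theorem2p2 (R : realType) (k : nat -> nat)
  (hk : forall n : nat, 10 * Num.sqrt (n%:R : R) <= (k n)%:R) :
  exists C0 r : R, 0 < C0 /\ 0 < r /\
    forall n : nat, (1 <= n)%N ->
      prob_gnp R (fun E : {set {set 'I_n}} =>
        [forall K : {set 'I_n}, (#|K| == k n) ==>
           let Gb := compl_graph (add_clique E K) in
           ((k n)%:R <= theta R Gb) &&
           (theta R Gb <= (k n)%:R + C0 * log2 (n%:R : R))])
      >= 1 - expR (- ((n%:R : R) `^ r)).
Proof.
(* 640 is the threshold on the fourth root of [n] in [failure_le]. *)
have [c c640] : exists c : R, c = 640 by exists 640.
have c_ge1 : 1 <= c by rewrite c640; lra.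
have c0 : 0 < c by lra.
have cC : 1601%:R <= c ^+ 4.
  have c2 : 640 * c <= c ^+ 2 by rewrite expr2 -{1}c640.
  have c4 : c ^+ 2 <= c ^+ 4 by rewrite ler_weXn2l.
  by apply: le_trans c4; apply: le_trans c2; rewrite c640; lra.
(* [C0] has two duties: to exceed every [n] below the threshold, and to exceed the 1601 that arises
   for large [n]. The choice [r = 1/2] matches failure [e^(-sqrt n)]. *)
exists (c ^+ 4), (2^-1); split; first by rewrite exprn_gt0.
split=> // n n_ge1; rewrite powR12_sqrt//; apply: prob_gnp_ge.
set q : R := Num.sqrt n%:R.
have n0 : 0 < n%:R :> R by rewrite ltr0n.
have q0 : 0 < q by rewrite sqrtr_gt0.
have qn : n%:R = q ^+ 2 by rewrite sqr_sqrtr// ltW.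
have kq : 10 * q <= (k n)%:R := hk n.
have k0 : (0 < k n)%N by rewrite -(ltr_nat R); lra.
have sure (P : pred {set {set 'I_n}}) : (forall E, P E) ->
    #|[set E in graphs n | ~~ P E]|%:R <= #|graphs n|%:R * expR (- q).
  move=> PE; rewrite (_ : [set E in graphs n | ~~ P E]%SET = finset.set0).
    by rewrite cards0 mulr_ge0// expR_ge0.
  by apply/finset.setP => E; rewrite !inE PE andbF.
(* For [k > n] there is no set [K]; otherwise [10 sqrt n <= k <= n] forces [sqrt n >= 10]. *)
have [nk|kn] := ltnP n (k n).
  apply: sure => E; apply/forallP => K; apply/implyP => /eqP Kk.
  by have := max_card (mem K); rewrite card_ord Kk leqNgt nk.
have q10 : 10 <= q.
  have : 10 * q <= q * q by rewrite -expr2 -qn (le_trans kq)// ler_nat.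
  by rewrite ler_pM2r.
have n2 : 2 <= n%:R :> R.
  have : 10 * q <= q * q by rewrite ler_pM2r.
  by rewrite qn expr2; lra.
have [lg1 lgL] := log2_bounds n2.
(* For small [n] the trivial bound [theta <= n < C0] suffices, as [log2 n >= 1]. *)
have [nc|cn] := ltP (n%:R : R) (c ^+ 4).
  apply: sure => E; apply/forallP => K; apply/implyP => /eqP Kk /=.
  rewrite -Kk theta_ge_planted ?Kk//=.
  apply: (le_trans (theta_le_order _ _ n_ge1)).
  apply: (le_trans (ltW nc)); rewrite -[leLHS]mulr1.
  by rewrite (le_trans (ler_wpM2l _ lg1)) ?exprn_ge0 ?(ltW c0)// lerDr.
pose L : R := ln n%:R; pose m := Num.truncn (800%:R * L).
(* Exceeds both 800 and [800 ln n] despite the truncation, yet is at most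
   [800 ln n + 801 <= 1601 log2 n]. *)
pose b := (m + 801)%N.
have L0 : 0 <= L by rewrite ln_ge0//; lra.
have /andP[m1 m2] : m%:R <= 800%:R * L < m.+1%:R by rewrite truncn_itv ?mulr_ge0 ?ler0n.
have m0 : 0 <= m%:R :> R by rewrite ler0n.
have bE : b%:R = m%:R + 801%:R :> R by rewrite natrD.
have b0 : (0 < b)%N by rewrite -(ltr_nat R) bE; lra.
apply: le_trans (_ : #|graphs n|%:R * (2 * expR (- (n%:R * (6 / 10))) +
    n%:R ^+ (k n + b) * expR (- (b%:R * (k n)%:R / 400%:R))) <= _); last first.
  apply: ler_wpM2l; first exact: ler0n.
  apply: (failure_le (c := c) (erefl q)) cn kq _ _; rewrite ?c640 ?bE//.

    by lra.
  by move: m2; rewrite -natr1 -/L; lra.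
apply: le_trans (planted_failure_count n_ge1 k0 b0 kq q10).
rewrite ler_nat; apply/subset_leq_card/fintype.subsetP => E.
rewrite !inE => /andP[-> /=]; apply: contraNN => /forallP thE.
apply/forallP => K; apply/implyP => Kk; have /implyP/(_ Kk) := thE K.
move: Kk => /eqP Kk h; rewrite -Kk theta_ge_planted ?Kk//=.
apply: (le_trans h); rewrite lerD2l bE.
apply: (@le_trans _ _ (1601%:R * log2 n%:R)); last first.
  by rewrite ler_wpM2r// (le_trans _ lg1).
by move: m1 lgL lg1; rewrite -/L; lra.
Qed.
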